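(* Let $\mathbb{X}$ be a tangent category with negatives, and $(K,H)$ an affine connection on an object $M$. Put $R:=\langle K,p\rangle:T^2(M)\to T_2(M)$, $U:=\langle T(p),p\rangle:T^2(M)\to T_2(M)$ and $\mu:=\langle\pi_0\ell,\pi_10\rangle T(+):T_2(M)\to T^2(M)$. Then $$F:=RH-U\mu:\ T^2(M)\to T^2(M)$$ satisfies $FF=-1$ (difference and negative taken in the bundle $p_{T(M)}:T^2(M)\to T(M)$).
   Context: Conventions: composites are written in diagrammatic order ($fg$ means first $f$, then $g$). $\langle f,g\rangle$ is the induced map into a pullback, $\pi_0,\pi_1$ are projections, $h\times k=\langle\pi_0h,\pi_1k\rangle$ between pullbacks. Component subscripts of natural transformations are often omitted. An additive bundle over $M$ is a map $q:E\to M$ whose finite wide pullbacks $E_n$ along itself exist, with maps $+_q:E_2\to E$, $0_q:M\to E$ making $q$ a commutative monoid in the slice over $M$. An additive bundle morphism $(f_1,f_0)$ from $q:E\to M$ to $q':E'\to M'$ is a pair $f_1:E\to E'$, $f_0:M\to M'$ with $f_1q'=qf_0$ preserving addition and zero. A tangent category is a category with a functor $T$ and natural transformations $p:T\to 1$, $0:1\to T$, $+:T_2\to T$, $\ell:T\to T^2$, $c:T^2\to T^2$ such that: each $(p_M,+_M,0_M)$ is an additive bundle, the wide pullbacks $T_nM$ of $p_M$ exist and are preserved by each $T^k$; $(\ell_M,0_M)$ is an additive bundle morphism from $(p_M,+_M,0_M)$ to $(T(p_M),T(+_M),T(0_M))$; $(c_M,1)$ is an additive bundle morphism from $(T(p_M),T(+_M),T(0_M))$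 to $(p_{TM},+_{TM},0_{TM})$; $c^2=1$, $\ell c=\ell$, $\ell_M\ell_{TM}=\ell_MT(\ell_M)$, $T(c)cT(c)=cT(c)c$, $\ell_{TM}T(c_M)c_{TM}=c_MT(\ell_M)$; and the square with top $\mu=\langle\pi_0\ell,\pi_10\rangle T(+):T_2M\to T^2M$, left $\pi_0p=\pi_1p$, right $T(p)$, bottom $0_M$ is a pullback preserved by each $T^k$. It has negatives if there is a natural transformation $n:T\to T$ making each $p_M$ a fibrewise abelian group; $f-g:=\langle f,gn\rangle+$. An affine vertical connection on $M$ is a map $K:T^2(M)\to T(M)$ with $\ell_MK=1$, $Kp=pp$, $K\ell_M=\ell_{TM}T(K)$ and $K\ell_M=T(\ell_M)c_{TM}T(K)$. An affine horizontal connection on $M$ is a map $H:T_2(M)\to T^2(M)$ with $HT(p)=\pi_0$, $Hp=\pi_1$, $H\ell_{TM}=(\ell_M\times0)T(H)$ and $HT(\ell_M)c_{TM}=(0\times\ell_M)T(H)$. An affine connection on $M$ is a pair $(K,H)$ of such with $HK=\pi_1p0$ and $\langle K,p\rangle\mu+UH=1_{T^2(M)}$ (sum in $p_{T(M)}$). *)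

(* Defs.v *)
From mathcomp Require Import ssreflect ssrfun ssrbool eqtype ssrnat fintype.

Set Implicit Arguments.
Unset Strict Implicit.
Unset Printing Implicit Defensive.

Declare Scope cat_scope.
Delimit Scope cat_scope with cat.
Local Open Scope cat_scope.

Reserved Notation "A ~> B" (at level 99, B at level 200).
Reserved Notation "f ;; g" (at level 50, left associativity).

Record category := Category {
  obj :> Type;
  hom : obj -> obj -> Type;
  idm : forall A, hom A A;
  comp : forall A B D, hom A B -> hom B D -> hom A D;
  comp1m : forall A B (f : hom A B), comp (idm A) f = f;
  compm1 : forall A B (f : hom A B), comp f (idm B) = f;
  compA : forall A B D E (f : hom A B) (g : hom B D) (h : hom D E),
    comp (comp f g) h = comp f (comp g h) }.

Arguments hom {c} A B.
Arguments idm {c} A.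
Arguments comp {c A B D} f g.

Notation "A ~> B" := (hom A B) : cat_scope.
(* Composition is in diagrammatic order: first [f], then [g]. *)
Notation "f ;; g" := (comp f g) : cat_scope.

Record functor (C D : category) := Functor {
  fobj :> C -> D;
  fmap : forall A B : C, (A ~> B) -> (fobj A ~> fobj B);
  fmap1 : forall A : C, fmap (idm A) = idm (fobj A);
  fmapM : forall (A B E : C) (f : A ~> B) (g : B ~> E),
    fmap (f ;; g) = fmap f ;; fmap g }.

Arguments fmap {C D} _ {A B} _.

Definition fid (C : category) : functor C C :=
  @Functor C C id (fun _ _ => id) (fun=> erefl) (fun _ _ _ _ _ => erefl).

Program Definition fcomp (C D E : category) (F : functor C D)
    (G : functor D E) : functor C E :=
  @Functor C E (fun A => G (F A)) (fun A B f => fmap G (fmap F f)) _ _.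
Next Obligation. by move=> C D E F G A /=; rewrite !fmap1. Qed.
Next Obligation. by move=> C D E F G A B X f g /=; rewrite !fmapM. Qed.

Fixpoint fpow (C : category) (F : functor C C) (k : nat) : functor C C :=
  if k is k'.+1 then fcomp (fpow F k') F else fid C.

(* The mediating arrow of a limit is carried as data; it is determined by the
   uniqueness clause. *)
Record is_pullback (C : category) (A B D P : C) (f : A ~> D) (g : B ~> D)
    (pr0 : P ~> A) (pr1 : P ~> B) := IsPullback {
  pb_comm : pr0 ;; f = pr1 ;; g;
  pb_pair : forall (X : C) (a : X ~> A) (b : X ~> B),
    a ;; f = b ;; g -> (X ~> P);
  pb_pair0 : forall (X : C) (a : X ~> A) (b : X ~> B) (e : a ;; f = b ;; g),
    pb_pair e ;; pr0 = a;
  pb_pair1 : forall (X : C) (a : X ~> A) (b : X ~> B) (e : a ;; f = b ;; g),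
    pb_pair e ;; pr1 = b;
  pb_uniq : forall (X : C) (h h' : X ~> P),
    h ;; pr0 = h' ;; pr0 -> h ;; pr1 = h' ;; pr1 -> h = h' }.

(* Wide pullback of the family constantly equal to [q], indexed by [I]. The arrow
   [base] to [M] is part of the cone, so that the empty wide pullback is [M]. *)
Record is_wide_pullback (C : category) (I : Type) (E M P : C) (q : E ~> M)
    (proj : I -> (P ~> E)) (base : P ~> M) := IsWidePullback {
  wp_comm : forall i, proj i ;; q = base;
  wp_tuple : forall (X : C) (x : X ~> M) (f : I -> (X ~> E)),
    (forall i, f i ;; q = x) -> (X ~> P);
  wp_proj : forall (X : C) (x : X ~> M) (f : I -> (X ~> E))
    (e : forall i, f i ;; q = x) i, wp_tuple e ;; proj i = f i;
  wp_base : forall (X : C) (x : X ~> M) (f : I -> (X ~> E))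
    (e : forall i, f i ;; q = x), wp_tuple e ;; base = x;
  wp_uniq : forall (X : C) (h h' : X ~> P),
    (forall i, h ;; proj i = h' ;; proj i) -> h ;; base = h' ;; base -> h = h' }.

(* [fp n] is the object E_n. *)
Record fibre_powers (C : category) (E M : C) (q : E ~> M) := FibrePowers {
  fp : nat -> C;
  fp_proj : forall n, 'I_n -> (fp n ~> E);
  fp_base : forall n, fp n ~> M;
  fp_wide : forall n, is_wide_pullback q (@fp_proj n) (fp_base n) }.

Arguments fp {C E M q} f n.
Arguments fp_proj {C E M q} f {n} i.
Arguments fp_base {C E M q} f n.
Arguments fp_wide {C E M q} f n.

Section Pairing.
Variables (C : category) (E M : C) (q : E ~> M) (B : fibre_powers q).

Definition pi0 : fp B 2 ~> E := fp_proj B (@Ordinal 2 0 isT).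
Definition pi1 : fp B 2 ~> E := fp_proj B (@Ordinal 2 1 isT).

Lemma pi01 : pi0 ;; q = pi1 ;; q.
Proof. by rewrite !(wp_comm (fp_wide B 2)). Qed.

Definition fam2 (X : C) (f g : X ~> E) (i : 'I_2) : X ~> E :=
  if val i is 0 then f else g.

Lemma fam2_comm (X : C) (f g : X ~> E) :
  f ;; q = g ;; q -> forall i, fam2 f g i ;; q = f ;; q.
Proof. by move=> e [[|i] lti]. Qed.

(* < f , g > : X -> E_2 *)
Definition bpair (X : C) (f g : X ~> E) (e : f ;; q = g ;; q) : X ~> fp B 2 :=
  wp_tuple (fp_wide B 2) (fam2_comm e).

Lemma pair_pi0 (X : C) (f g : X ~> E) (e : f ;; q = g ;; q) :
  bpair e ;; pi0 = f.
Proof. by rewrite /bpair /pi0 wp_proj. Qed.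

Lemma pair_pi1 (X : C) (f g : X ~> E) (e : f ;; q = g ;; q) :
  bpair e ;; pi1 = g.
Proof. by rewrite /bpair /pi1 wp_proj. Qed.

Lemma pair_ext (X : C) (h h' : X ~> fp B 2) :
  h ;; pi0 = h' ;; pi0 -> h ;; pi1 = h' ;; pi1 -> h = h'.
Proof.
move=> e0 e1; apply: (wp_uniq (fp_wide B 2)).
  case=> [[|[|i]] lti] //.
    by have -> : Ordinal lti = @Ordinal 2 0 isT by apply: val_inj.
  by have -> : Ordinal lti = @Ordinal 2 1 isT by apply: val_inj.
by rewrite -(wp_comm (fp_wide B 2) (@Ordinal 2 0 isT)) -!compA -/pi0 e0.
Qed.

Lemma comp_pair (X Y : C) (h : Y ~> X) (f g : X ~> E) (e : f ;; q = g ;; q)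
    (e' : h ;; f ;; q = h ;; g ;; q) :
  h ;; bpair e = bpair e'.
Proof. by apply: pair_ext; rewrite compA ?pair_pi0 ?pair_pi1. Qed.

End Pairing.

Arguments bpair {C E M q} B {X f g} e.

Record additive_data (C : category) (E M : C) (q : E ~> M) := AdditiveData {
  ad_powers :> fibre_powers q;
  badd : fp ad_powers 2 ~> E;
  bzero : M ~> E;
  add_over : badd ;; q = pi0 ad_powers ;; q;
  zero_over : bzero ;; q = idm M }.

Arguments badd {C E M q} a.
Arguments bzero {C E M q} a.

Section FibrewiseSum.
Variables (C : category) (E M : C) (q : E ~> M) (B : additive_data q).

Definition fsum (X : C) (f g : X ~> E) (e : f ;; q = g ;; q) : X ~> E :=
  bpair B e ;; badd B.

Lemma sum_over (X : C) (f g : X ~> E) (e : f ;; q = g ;; q) :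
  fsum e ;; q = f ;; q.
Proof. by rewrite /fsum compA add_over -compA pair_pi0. Qed.

Definition pi3 (i : 'I_3) : fp B 3 ~> E := fp_proj B i.
Definition i30 : 'I_3 := @Ordinal 3 0 isT.
Definition i31 : 'I_3 := @Ordinal 3 1 isT.
Definition i32 : 'I_3 := @Ordinal 3 2 isT.

Lemma pi3_over (i j : 'I_3) : pi3 i ;; q = pi3 j ;; q.
Proof. by rewrite /pi3 !(wp_comm (fp_wide B 3)). Qed.

Lemma suml_over :
  fsum (pi3_over i30 i31) ;; q = pi3 i32 ;; q.
Proof. by rewrite sum_over; apply: pi3_over. Qed.

Lemma sumr_over :
  pi3 i30 ;; q = fsum (pi3_over i31 i32) ;; q.
Proof. by rewrite sum_over; apply: pi3_over. Qed.

Lemma zero1_over : (q ;; bzero B) ;; q = idm E ;; q.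
Proof. by rewrite compA zero_over compm1 comp1m. Qed.

End FibrewiseSum.

Arguments fsum {C E M q} B {X f g} e.

(* Commutative monoid in the slice over [M], with carrier [q]. *)
Record additive_bundle (C : category) (E M : C) (q : E ~> M) := AdditiveBundle {
  ab_data :> additive_data q;
  ab_addA : fsum ab_data (suml_over ab_data) = fsum ab_data (sumr_over ab_data);
  ab_addC : fsum ab_data (esym (pi01 ab_data)) = badd ab_data;
  ab_add0 : fsum ab_data (zero1_over ab_data) = idm E }.

Section AdditiveMorphism.
Variables (C : category) (E M : C) (q : E ~> M) (E' M' : C) (q' : E' ~> M').
Variables (B : additive_bundle q) (B' : additive_bundle q').
Variables (f1 : E ~> E') (f0 : M ~> M').

Lemma square_over (f1q : f1 ;; q' = q ;; f0) :
  (pi0 B ;; f1) ;; q' = (pi1 B ;; f1) ;; q'.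
Proof. by rewrite !compA f1q -!compA pi01. Qed.

Record is_additive_morphism : Prop := IsAdditiveMorphism {
  am_over : f1 ;; q' = q ;; f0;
  am_add : badd B ;; f1 = bpair B' (square_over am_over) ;; badd B';
  am_zero : bzero B ;; f1 = f0 ;; bzero B' }.

End AdditiveMorphism.

(* The image of an additive bundle under a functor preserving its powers. *)
Section ImageBundle.
Variables (C D : category) (F : functor C D) (E M : C) (q : E ~> M).
Variable B : additive_bundle q.
Hypothesis pres : forall n,
  is_wide_pullback (fmap F q) (fun i => fmap F (fp_proj B i))
    (fmap F (fp_base B n)).

Definition image_powers : fibre_powers (fmap F q) :=
  @FibrePowers D (F E) (F M) (fmap F q) (fun n => F (fp B n))
    (fun n i => fmap F (fp_proj B i)) (fun n => fmap F (fp_base B n)) pres.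

Program Definition image_data : additive_data (fmap F q) :=
  @AdditiveData D (F E) (F M) (fmap F q) image_powers
    (fmap F (badd B)) (fmap F (bzero B)) _ _.
Next Obligation. by rewrite -!fmapM add_over. Qed.
Next Obligation. by rewrite -!fmapM zero_over fmap1. Qed.

Lemma image_sum (X : C) (f g : X ~> E) (e : f ;; q = g ;; q)
    (f' g' : F X ~> F E) (e' : f' ;; fmap F q = g' ;; fmap F q) :
  f' = fmap F f -> g' = fmap F g -> fsum image_data e' = fmap F (fsum B e).
Proof.
move=> ef eg; rewrite /fsum fmapM; congr (_ ;; _).
apply: pair_ext; rewrite ?pair_pi0 ?pair_pi1 /= /pi0 /pi1 /= -fmapM.
  by rewrite -/(pi0 B) pair_pi0.
by rewrite -/(pi1 B) pair_pi1.
Qed.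

Program Definition image_bundle : additive_bundle (fmap F q) :=
  @AdditiveBundle D (F E) (F M) (fmap F q) image_data _ _ _.
Next Obligation.
transitivity (fmap F (fsum B (suml_over B))).
  by apply: image_sum => //; apply: image_sum.
by rewrite ab_addA; apply/esym/image_sum => //; apply: image_sum.
Qed.
Next Obligation.
by rewrite (image_sum (esym (pi01 B))) // ab_addC.
Qed.
Next Obligation.
transitivity (fmap F (fsum B (zero1_over B))); last by rewrite ab_add0 fmap1.
by apply: image_sum; rewrite ?fmapM ?fmap1.
Qed.

End ImageBundle.

(* The tangent functor, the projection and its additive bundles; [fp (t_bundle M) n]
   is the object T_n M. *)
Record tangent_base (C : category) := TangentBase {
  T : functor C C;
  p : forall M : C, T M ~> M;
  p_natural : forall (M N : C) (f : M ~> N), fmap T f ;; p N = p M ;; f;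
  t_bundle : forall M : C, additive_bundle (p M);
  t_pres : forall (k n : nat) (M : C),
    is_wide_pullback (fmap (fpow T k) (p M))
      (fun i : 'I_n => fmap (fpow T k) (fp_proj (t_bundle M) i))
      (fmap (fpow T k) (fp_base (t_bundle M) n)) }.

Notation T2 X M := (fp (t_bundle X M) 2).
Notation tplus X M := (badd (t_bundle X M)).
Notation tzero X M := (bzero (t_bundle X M)).

Section TangentBase.
Variables (C : category) (X : tangent_base C).

(* (T(p_M), T(+_M), T(0_M)) *)
Definition Tt_bundle (M : C) : additive_bundle (fmap (T X) (p X M)) :=
  @image_bundle C C (T X) (T X M) M (p X M) (t_bundle X M)
    (fun n => t_pres X 1 n M).

Lemma T2_map_over (M N : C) (f : M ~> N) :
  (pi0 (t_bundle X M) ;; fmap (T X) f) ;; p X N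
    = (pi1 (t_bundle X M) ;; fmap (T X) f) ;; p X N.
Proof. by rewrite !compA p_natural -!compA pi01. Qed.

Definition T2_map (M N : C) (f : M ~> N) : T2 X M ~> T2 X N :=
  bpair (t_bundle X N) (T2_map_over f).

End TangentBase.

Record tangent_ops (C : category) := TangentOps {
  t_base :> tangent_base C;
  plus_natural : forall (M N : C) (f : M ~> N),
    T2_map t_base f ;; tplus t_base N = tplus t_base M ;; fmap (T t_base) f;
  zero_natural : forall (M N : C) (f : M ~> N),
    f ;; tzero t_base N = tzero t_base M ;; fmap (T t_base) f;
  ell : forall M : C, T t_base M ~> T t_base (T t_base M);
  ell_natural : forall (M N : C) (f : M ~> N),
    fmap (T t_base) f ;; ell N = ell M ;; fmap (T t_base) (fmap (T t_base) f);
  flip : forall M : C, T t_base (T t_base M) ~> T t_base (T t_base M);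
  flip_natural : forall (M N : C) (f : M ~> N),
    fmap (T t_base) (fmap (T t_base) f) ;; flip N
      = flip M ;; fmap (T t_base) (fmap (T t_base) f);
  ell_additive : forall M : C,
    is_additive_morphism (t_bundle t_base M) (Tt_bundle t_base M)
      (ell M) (tzero t_base M);
  flip_additive : forall M : C,
    is_additive_morphism (Tt_bundle t_base M) (t_bundle t_base (T t_base M))
      (flip M) (idm (T t_base M)) }.

Section Mu.
Variables (C : category) (X : tangent_ops C) (M : C).

Lemma ell_zero_over :
  (pi0 (t_bundle X M) ;; ell X M) ;; fmap (T X) (p X M)
    = (pi1 (t_bundle X M) ;; tzero X (T X M)) ;; fmap (T X) (p X M).
Proof.
rewrite !compA (am_over (ell_additive X M)) -zero_natural.
by rewrite -!compA pi01.
Qed.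

Lemma zero_ell_over :
  (pi0 (t_bundle X M) ;; tzero X (T X M)) ;; fmap (T X) (p X M)
    = (pi1 (t_bundle X M) ;; ell X M) ;; fmap (T X) (p X M).
Proof.
rewrite !compA (am_over (ell_additive X M)) -zero_natural.
by rewrite -!compA pi01.
Qed.

(* ell x 0 = < pi0 ell , pi1 0 >, the zero being that of T M *)
Definition ell_times_zero : T2 X M ~> T X (T2 X M) :=
  bpair (Tt_bundle X M) ell_zero_over.

Definition zero_times_ell : T2 X M ~> T X (T2 X M) :=
  bpair (Tt_bundle X M) zero_ell_over.

Definition mu : T2 X M ~> T X (T X M) := ell_times_zero ;; fmap (T X) (tplus X M).

End Mu.

Record tangent_structure (C : category) := TangentStructure {
  t_ops :> tangent_ops C;
  flip_flip : forall M : C, flip t_ops M ;; flip t_ops M = idm _;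
  ell_flip : forall M : C, ell t_ops M ;; flip t_ops M = ell t_ops M;
  ell_ell : forall M : C,
    ell t_ops M ;; ell t_ops (T t_ops M)
      = ell t_ops M ;; fmap (T t_ops) (ell t_ops M);
  flip_hexagon : forall M : C,
    fmap (T t_ops) (flip t_ops M) ;; flip t_ops (T t_ops M)
        ;; fmap (T t_ops) (flip t_ops M)
      = flip t_ops (T t_ops M) ;; fmap (T t_ops) (flip t_ops M)
        ;; flip t_ops (T t_ops M);
  ell_flip_flip : forall M : C,
    ell t_ops (T t_ops M) ;; fmap (T t_ops) (flip t_ops M)
        ;; flip t_ops (T t_ops M)
      = flip t_ops M ;; fmap (T t_ops) (ell t_ops M);
  mu_universal : forall (k : nat) (M : C),
    is_pullback (fmap (fpow (T t_ops) k) (tzero t_ops M))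
      (fmap (fpow (T t_ops) k) (fmap (T t_ops) (p t_ops M)))
      (fmap (fpow (T t_ops) k) (pi0 (t_bundle t_ops M) ;; p t_ops M))
      (fmap (fpow (T t_ops) k) (mu t_ops M)) }.

Record negatives_data (C : category) (X : tangent_structure C) := NegativesData {
  neg :> forall M : C, T X M ~> T X M;
  neg_natural : forall (M N : C) (f : M ~> N),
    fmap (T X) f ;; neg N = neg M ;; fmap (T X) f;
  neg_over : forall M : C, neg M ;; p X M = p X M }.

Section Difference.
Variables (C : category) (X : tangent_structure C) (N : negatives_data X).

Lemma neg_over_sym (M : C) : idm _ ;; p X M = N M ;; p X M.
Proof. by rewrite comp1m neg_over. Qed.

Variables (A M : C) (f g : A ~> T X M).

Lemma diff_over : f ;; p X M = g ;; p X M -> f ;; p X M = (g ;; N M) ;; p X M.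
Proof. by rewrite compA neg_over. Qed.

(* f - g = < f , g n > + *)
Definition diff (e : f ;; p X M = g ;; p X M) : A ~> T X M :=
  fsum (t_bundle X M) (diff_over e).

End Difference.

Arguments diff {C X} N {A M f g} e.

Record negatives (C : category) (X : tangent_structure C) := Negatives {
  neg_data :> negatives_data X;
  neg_inv : forall M : C,
    fsum (t_bundle X M) (neg_over_sym neg_data M) = p X M ;; tzero X M }.

Section Connections.
Variables (C : category) (X : tangent_structure C) (M : C).

Local Notation T := (T X).
Local Notation p := (p X).
Local Notation pi0 := (pi0 (t_bundle X M)).
Local Notation pi1 := (pi1 (t_bundle X M)).

Record vertical_connection := VerticalConnection {
  vc :> T (T M) ~> T M;
  vc_ell : ell X M ;; vc = idm (T M);
  vc_over : vc ;; p M = p (T M) ;; p M;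
  vc_lin : vc ;; ell X M = ell X (T M) ;; fmap T vc;
  vc_lin' : vc ;; ell X M = fmap T (ell X M) ;; flip X (T M) ;; fmap T vc }.

Record horizontal_connection := HorizontalConnection {
  hc :> T2 X M ~> T (T M);
  hc_Tp : hc ;; fmap T (p M) = pi0;
  hc_p : hc ;; p (T M) = pi1;
  hc_lin : hc ;; ell X (T M) = ell_times_zero X M ;; fmap T hc;
  hc_lin' : hc ;; fmap T (ell X M) ;; flip X (T M)
              = zero_times_ell X M ;; fmap T hc }.

Lemma Tp_p_over : fmap T (p M) ;; p M = p (T M) ;; p M.
Proof. exact: p_natural. Qed.

(* U = < T(p) , p > *)
Definition Umap : T (T M) ~> T2 X M := bpair (t_bundle X M) Tp_p_over.

(* R = < K , p > *)
Definition Rmap (K : vertical_connection) : T (T M) ~> T2 X M :=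
  bpair (t_bundle X M) (vc_over K).

Lemma mu_p : mu X M ;; p (T M) = pi1.
Proof.
have ellp : ell X M ;; p (T M) = p M ;; tzero X M.
  have /= flip_p := am_over (flip_additive X M).
  rewrite -(ell_flip X M) compA flip_p compm1.
  exact: (am_over (ell_additive X M)).
rewrite /mu compA p_natural -compA.
have e : (pi0 ;; p M ;; tzero X M) ;; p M = pi1 ;; p M.
  by rewrite compA  zero_over compm1 pi01.
have /= e0 : _ = pi0 ;; ell X M := pair_pi0 (Tt_bundle X M) (ell_zero_over X M).
have /= e1 : _ = pi1 ;; tzero X (T M) :=
  pair_pi1 (Tt_bundle X M) (ell_zero_over X M).
have -> : ell_times_zero X M ;; p (T2 X M) = bpair (t_bundle X M) e.
  apply: pair_ext; rewrite ?pair_pi0 ?pair_pi1 compA.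
    by rewrite -(p_natural X pi0) -compA [X in X ;; _]e0 !compA ellp.
  rewrite -(p_natural X pi1) -compA [X in X ;; _]e1 !compA .
  by rewrite zero_over compm1.
have e' : pi1 ;; (p M ;; tzero X M) ;; p M = (pi1 ;; idm _) ;; p M.
  by rewrite !compA  zero_over comp1m compm1.
have -> : bpair (t_bundle X M) e
    = pi1 ;; bpair (t_bundle X M) (zero1_over (t_bundle X M)).
  rewrite (comp_pair _ _ e').
  apply: pair_ext; rewrite ?pair_pi0 ?pair_pi1 ?compm1 // -compA.
  by rewrite pi01.
rewrite compA; have /= := ab_add0 (t_bundle X M); rewrite /fsum => ->.
by rewrite compm1.
Qed.

Lemma Rmu_UH_over (K : vertical_connection) (H : horizontal_connection) :
  (Rmap K ;; mu X M) ;; p (T M) = (Umap ;; H) ;; p (T M).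
Proof. by rewrite 2!compA mu_p hc_p !pair_pi1. Qed.

Record affine_connection := AffineConnection {
  ac_K : vertical_connection;
  ac_H : horizontal_connection;
  ac_HK : ac_H ;; ac_K = pi1 ;; p M ;; tzero X M;
  ac_sum : fsum (t_bundle X (T M)) (Rmu_UH_over ac_K ac_H) = idm (T (T M)) }.

Lemma RH_Umu_over (D : affine_connection) :
  (Rmap (ac_K D) ;; ac_H D) ;; p (T M) = (Umap ;; mu X M) ;; p (T M).
Proof. by rewrite 2!compA mu_p hc_p !pair_pi1. Qed.

(* F = R H - U mu *)
Definition connF (N : negatives X) (D : affine_connection) : T (T M) ~> T (T M) :=
  diff N (RH_Umu_over D).

End Connections.

(* Main.v *)
From mathcomp Require Import ssreflect ssrfun ssrbool eqtype ssrnat fintype.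
Require Import Defs.

Set Implicit Arguments.
Unset Strict Implicit.
Unset Printing Implicit Defensive.

Local Open Scope cat_scope.

(** On the second tangent bundle of [M], an affine connection gives the three
    coordinates [T p], [K] and [p], and the claim is that [F] acts on them like
    the rotation [(x, k, b) |-> (k, - x, b)].

    Both composites with [T p] and [K] are computed summand by summand: [T p]
    and [K] are additive for the bundle [p], and [H] and [mu] are complementary,
    [H T(p) = pi0] and [mu K = pi0] whereas [H K] and [mu T(p)] vanish.  So
    [F T(p) = K], [F K = - T(p)] and [F p = p] ([connF_Tp], [connF_K],
    [connF_p]), whence [F U = R] and [F R = < - T(p) , p >].  Since [H] commutes
    with negation in its first variable ([hc_neg]),
    [F F = F R H - F U mu = - U H - R mu], and the axiom [R mu + U H = 1] of an
    affine connection turns this into [-1].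

    The additivity of [K] and the homogeneity of [H] are not axioms; they follow
    from linearity, that is, from compatibility with the vertical lift [ell].
    For an arrow of the form [T(f)] additivity and compatibility with negation
    are instances of naturality; a linear arrow [f] satisfies an equation of the
    shape [f ell = ell T(f)], and [ell] is itself additive and has a retraction,
    so that the property descends from [T(f)] to [f]. *)

(** * Fibrewise sums as a relation *)

Section Sums.
Variables (C : category) (E M : C) (q : E ~> M).

(** The graph of fibrewise addition.  Unlike [fsum], it does not depend on a
    proof that the summands lie over the same base arrow, so that equations
    between arrows can be rewritten in its arguments. *)
Definition is_sum (B : additive_data q) (Y : C) (f g h : Y ~> E) : Prop :=
  exists s : Y ~> fp B 2,
    [/\ s ;; pi0 B = f, s ;; pi1 B = g & s ;; badd B = h].

Lemma is_sum_fsum (B : additive_data q) (Y : C) (f g : Y ~> E)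
    (e : f ;; q = g ;; q) : is_sum B f g (fsum B e).
Proof. by exists (bpair B e); rewrite pair_pi0 pair_pi1. Qed.

Lemma is_sum_unique (B : additive_data q) (Y : C) (f g h h' : Y ~> E) :
  is_sum B f g h -> is_sum B f g h' -> h = h'.
Proof.
move=> [s [s0 s1 <-]] [t [t0 t1 <-]]; congr (_ ;; _).
by apply: pair_ext; rewrite ?s0 ?s1.
Qed.

Lemma is_sum_over (B : additive_data q) (Y : C) (f g h : Y ~> E) :
  is_sum B f g h -> f ;; q = g ;; q /\ h ;; q = f ;; q.
Proof.
by move=> [s [<- <- <-]]; rewrite !compA add_over pi01.
Qed.

Lemma is_sum_precomp (B : additive_data q) (Y Z : C) (k : Z ~> Y)
    (f g h : Y ~> E) :
  is_sum B f g h -> is_sum B (k ;; f) (k ;; g) (k ;; h).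
Proof. by move=> [s [<- <- <-]]; exists (k ;; s); rewrite !compA. Qed.

Variable B : additive_bundle q.

Lemma is_sumC (Y : C) (f g h : Y ~> E) : is_sum B f g h -> is_sum B g f h.
Proof.
move=> [s [<- <- <-]]; rewrite -(ab_addC B).
by apply: is_sum_precomp; apply: is_sum_fsum.
Qed.

Lemma is_sum_zero (Y : C) (f : Y ~> E) : is_sum B f (f ;; q ;; bzero B) f.
Proof.
rewrite -{1 3}(compm1 f) compA; apply/is_sum_precomp/is_sumC.
by rewrite -{2}(ab_add0 B); apply: is_sum_fsum.
Qed.

Lemma is_sumA (Y : C) (f g h u v r : Y ~> E) :
  is_sum B f g u -> is_sum B g h v -> is_sum B u h r -> is_sum B f v r.
Proof.
move=> sfg sgh suh.
pose fam (i : 'I_3) := match val i with 0 => f | 1 => g | _ => h end.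
have famq i : fam i ;; q = f ;; q.
  have [fg _] := is_sum_over sfg; have [gh _] := is_sum_over sgh.
  by case: i => [[|[|i]] lti] //; rewrite /fam /= -?gh fg.
pose t := wp_tuple (fp_wide B 3) famq.
have t0 : t ;; pi3 B i30 = f by apply: wp_proj.
have t1 : t ;; pi3 B i31 = g by apply: wp_proj.
have t2 : t ;; pi3 B i32 = h by apply: wp_proj.
have su := is_sum_precomp t (is_sum_fsum B (pi3_over B i30 i31)).
have sv := is_sum_precomp t (is_sum_fsum B (pi3_over B i31 i32)).
rewrite t0 t1 in su; rewrite t1 t2 in sv.
have sl := is_sum_precomp t (is_sum_fsum B (suml_over B)).
have sr := is_sum_precomp t (is_sum_fsum B (sumr_over B)).
rewrite t2 -(is_sum_unique sfg su) in sl.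
rewrite t0 -(is_sum_unique sgh sv) -ab_addA in sr.
by rewrite (is_sum_unique suh sl).
Qed.

End Sums.

Definition preserves_sums (C : category) (E M : C) (q : E ~> M)
    (B : additive_data q) (E' M' : C) (q' : E' ~> M') (B' : additive_data q')
    (f : E ~> E') : Prop :=
  forall (Y : C) (a b h : Y ~> E),
    is_sum B a b h -> is_sum B' (a ;; f) (b ;; f) (h ;; f).

Lemma additive_preserves_sums (C : category) (E M : C) (q : E ~> M)
    (E' M' : C) (q' : E' ~> M') (B : additive_bundle q)
    (B' : additive_bundle q') (f1 : E ~> E') (f0 : M ~> M') :
  is_additive_morphism B B' f1 f0 -> preserves_sums B B' f1.
Proof.
move=> [over add _] Y a b h [s [<- <- <-]].
exists (s ;; bpair B' (square_over B over)).
by rewrite !compA pair_pi0 pair_pi1 add.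
Qed.

(** * Sums and negatives in the tangent bundles *)

Section Tangent.
Variables (C : category) (X : tangent_structure C).

Local Notation T := (T X).
Local Notation p := (p X).
Local Notation zero := (fun M => tzero X M).
Local Notation TB := (t_bundle X).

Lemma T_preserves_sums (A B : C) (f : A ~> B) :
  preserves_sums (TB A) (TB B) (fmap T f).
Proof.
move=> Y a b h [s [<- <- <-]]; exists (s ;; T2_map X f).
by rewrite !compA pair_pi0 pair_pi1 plus_natural.
Qed.

(** The axiom on [ell] concerns the bundle [T(p)]; as [ell] absorbs the flip,
    which exchanges [T(p)] and [p], it is additive for [p] as well. *)
Lemma ell_preserves_sums (M : C) : preserves_sums (TB M) (TB (T M)) (ell X M).
Proof.
move=> Y a b h sab; rewrite -(ell_flip X M) -!compA.
apply: (additive_preserves_sums (flip_additive X M)).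
exact: (additive_preserves_sums (ell_additive X M)).
Qed.

Lemma T_image_preserves_sums (A B : C) (f : T A ~> T B) :
  preserves_sums (TB A) (TB B) f ->
  preserves_sums (Tt_bundle X A) (Tt_bundle X B) (fmap T f).
Proof.
move=> fS Y a b h [s [<- <- <-]].
have [t [t0 t1 ta]]: is_sum (TB B) (pi0 (TB A) ;; f) (pi1 (TB A) ;; f)
    (badd (TB A) ;; f).
  by apply: fS; exists (idm _); rewrite !comp1m.
exists (s ;; fmap T t).
by rewrite /pi0 /pi1 /= !compA -!fmapM -t0 -t1 -ta.
Qed.

Lemma ell_p (M : C) : ell X M ;; p (T M) = p M ;; zero M.
Proof.
have /= flip_p := am_over (flip_additive X M).
rewrite -(ell_flip X M) compA flip_p compm1.
exact: (am_over (ell_additive X M)).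
Qed.

Lemma ell_reflects_sums (M Y : C) (a b h : Y ~> T M) :
  (forall g g' : Y ~> T M, g ;; ell X M = g' ;; ell X M -> g = g') ->
  is_sum (TB (T M)) (a ;; ell X M) (b ;; ell X M) (h ;; ell X M) ->
  is_sum (TB M) a b h.
Proof.
move=> ell_mono sab.
have ab : a ;; p M = b ;; p M.
  have [/(congr1 (fun k => k ;; p M)) /=] := is_sum_over sab.
  by rewrite (compA a) (compA b) ell_p !compA zero_over !compm1.
suff -> : h = fsum (TB M) ab by apply: is_sum_fsum.
apply: ell_mono; apply: is_sum_unique sab _; apply: ell_preserves_sums.
exact: is_sum_fsum.
Qed.

Lemma mu_is_sum (M : C) :
  is_sum (Tt_bundle X M) (pi0 (TB M) ;; ell X M) (pi1 (TB M) ;; zero (T M))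
    (mu X M).
Proof. exact: is_sum_fsum. Qed.

Lemma mu_Tp (M : C) :
  mu X M ;; fmap T (p M) = pi0 (TB M) ;; p M ;; zero M.
Proof. exact/esym/(pb_comm (mu_universal X 0 M)). Qed.

Variable N : negatives X.

Lemma is_sum_neg (M Y : C) (f : Y ~> T M) :
  is_sum (TB M) f (f ;; N M) (f ;; p M ;; zero M).
Proof.
rewrite -{1}(compm1 f) compA; apply: is_sum_precomp.
by rewrite -(neg_inv N M); apply: is_sum_fsum.
Qed.

Lemma neg_unique (M Y : C) (f g : Y ~> T M) :
  is_sum (TB M) f g (f ;; p M ;; zero M) -> g = f ;; N M.
Proof.
move=> sfg; have [fg _] := is_sum_over sfg.
have sg : is_sum (TB M) g (f ;; p M ;; zero M) g.
  by rewrite fg; apply: is_sum_zero.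
apply: is_sum_unique sg _; apply: is_sumA (is_sumC sfg) (is_sum_neg f) _.
apply: is_sumC; have := is_sum_zero (TB M) (f ;; N M).
by rewrite (compA f) neg_over.
Qed.

Lemma is_sum_idem (M Y : C) (f : Y ~> T M) :
  is_sum (TB M) f f f -> f = f ;; p M ;; zero M.
Proof.
move=> sff; apply: is_sum_unique (is_sum_zero (TB M) f) _.
exact: is_sumA sff (is_sum_neg f) (is_sum_neg f).
Qed.

Lemma is_sum_zz (M Y : C) (f : Y ~> M) :
  is_sum (TB M) (f ;; zero M) (f ;; zero M) (f ;; zero M).
Proof.
have := is_sum_zero (TB M) (f ;; zero M).
by rewrite (compA f) zero_over compm1.
Qed.

Lemma zero_neg (M : C) : zero M ;; N M = zero M.
Proof.
apply/esym/neg_unique; rewrite zero_over comp1m.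
by have := is_sum_zz (idm M); rewrite comp1m.
Qed.

(** Preservation of zeros is not assumed: the image of a zero is idempotent for
    addition, and in a fibrewise group only zeros are. *)
Lemma preserves_sums_zero (A B : C) (f : T A ~> T B) :
  preserves_sums (TB A) (TB B) f ->
  p A ;; zero A ;; f = f ;; p B ;; zero B.
Proof.
move=> fS; rewrite (is_sum_idem (fS _ _ _ _ (is_sum_zz (p A)))).
have := is_sum_neg (idm (T A)); rewrite !comp1m => /fS /is_sum_over [_ ->].
by rewrite comp1m.
Qed.

Lemma preserves_sums_neg (A B : C) (f : T A ~> T B) :
  preserves_sums (TB A) (TB B) f -> N A ;; f = f ;; N B.
Proof.
move=> fS; apply: neg_unique; rewrite -preserves_sums_zero //.
by have := is_sum_neg (idm (T A)); rewrite !comp1m => /fS; rewrite comp1m.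
Qed.

Lemma neg_preserves_sums (M : C) : preserves_sums (TB M) (TB M) (N M).
Proof.
move=> Y a b h sab; have [ab ha] := is_sum_over sab.
have abN : (a ;; N M) ;; p M = (b ;; N M) ;; p M by rewrite !compA neg_over.
have sr := is_sum_fsum (TB M) abN; move: (fsum _ _) sr => r sr.
suff <- : r = h ;; N M by [].
have [_ ra] := is_sum_over sr.
have hr : h ;; p M = r ;; p M by rewrite ha ra compA neg_over.
(* b + (- a - b) = - a, hence h + (- a - b) = a - a *)
have sbr : is_sum (TB M) b r (a ;; N M).
  apply: is_sumA (is_sum_neg b) (is_sumC sr) _; apply: is_sumC.
  have := is_sum_zero (TB M) (a ;; N M).
  by rewrite (compA a) neg_over ab.
have shr := is_sum_fsum (TB M) hr.
apply: neg_unique; rewrite ha.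
by rewrite -{1}(is_sum_unique (is_sumA sab sbr shr) (is_sum_neg a)).
Qed.

(** * Linear arrows *)

Lemma linear_preserves_sums (A B : C) (f : T A ~> T B) :
  (forall (Y : C) (g g' : Y ~> T B), g ;; ell X B = g' ;; ell X B -> g = g') ->
  f ;; ell X B = ell X A ;; fmap T f ->
  preserves_sums (TB A) (TB B) f.
Proof.
move=> ell_mono fl Y a b h sab; apply: ell_reflects_sums; first exact: ell_mono.
rewrite !(compA _ f) fl -!compA.
by apply/T_preserves_sums/ell_preserves_sums.
Qed.

Variable M : C.

Local Notation pi0 := (pi0 (TB M)).
Local Notation pi1 := (pi1 (TB M)).

Section Vertical.
Variable K : vertical_connection X M.

Lemma ell_mono (Y : C) (g g' : Y ~> T M) :
  g ;; ell X M = g' ;; ell X M -> g = g'.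
Proof.
by move/(congr1 (fun k => k ;; K)); rewrite !compA vc_ell !compm1.
Qed.

(** By [ell_flip_flip], conjugating with flips turns [ell (T M)] into
    [T(ell M)], which is split by [T(K)]. *)
Lemma ell_T_mono (Y : C) (g g' : Y ~> T (T M)) :
  g ;; ell X (T M) = g' ;; ell X (T M) -> g = g'.
Proof.
move=> e; have split : ell X (T M) ;; (fmap T (flip X M) ;; flip X (T M) ;;
    fmap T K ;; flip X M) = idm _.
  rewrite -!compA ell_flip_flip (compA (flip X M)) -fmapM vc_ell fmap1 compm1.
  exact: flip_flip.
by rewrite -(compm1 g) -(compm1 g') -split -!(compA _ (ell X _)) e.
Qed.

Lemma vc_preserves_sums : preserves_sums (TB (T M)) (TB M) K.
Proof. by apply: linear_preserves_sums (vc_lin K); apply: ell_mono. Qed.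

Lemma vc_preserves_T_sums : preserves_sums (Tt_bundle X M) (TB M) K.
Proof.
move=> Y a b h sab; apply: ell_reflects_sums; first exact: ell_mono.
rewrite !(compA _ K) vc_lin' -!compA; apply: T_preserves_sums.
apply: (additive_preserves_sums (flip_additive X (T M))).
exact: T_image_preserves_sums (@ell_preserves_sums M) _ _ _ _ sab.
Qed.

Lemma mu_vc : mu X M ;; K = pi0.
Proof.
have := vc_preserves_T_sums (mu_is_sum M).
rewrite (compA pi0) vc_ell compm1 => smu; apply/esym/is_sum_unique/smu.
(* the second summand is the zero in the fibre of [pi0] *)
suff -> : pi1 ;; zero (T M) ;; K = pi0 ;; p M ;; zero M by apply: is_sum_zero.
have e : zero (T M) ;; K = p M ;; zero M.
  rewrite -[LHS]comp1m -(zero_over (TB (T M))) -!compA.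
  rewrite (compA _ (p _) (bzero _)) (compA _ (p _ ;; bzero _)).
  rewrite preserves_sums_zero; last exact: vc_preserves_sums.
  by rewrite vc_over -!compA zero_over comp1m.
by rewrite compA e -compA pi01.
Qed.

(** [ell x 0] commutes with negation in the first variable because negation
    commutes with [ell] and fixes zeros; the equation [H ell = (ell x 0) T(H)]
    then carries this over to [H], negation being natural in [T(H)]. *)
Lemma hc_neg (H : horizontal_connection X M) (Y : C) (s s' : Y ~> T2 X M) :
  s' ;; pi0 = s ;; pi0 ;; N M -> s' ;; pi1 = s ;; pi1 ->
  s' ;; H = s ;; H ;; N (T M).
Proof.
move=> s0 s1; apply: ell_T_mono.
have e0 : ell_times_zero X M ;; fmap T pi0 = pi0 ;; ell X M
  := pair_pi0 (Tt_bundle X M) (ell_zero_over X M).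
have e1 : ell_times_zero X M ;; fmap T pi1 = pi1 ;; zero (T M)
  := pair_pi1 (Tt_bundle X M) (ell_zero_over X M).
have es : s' ;; ell_times_zero X M = s ;; ell_times_zero X M ;; N (T2 X M).
  have Nell : N M ;; ell X M = ell X M ;; N (T M).
    exact/preserves_sums_neg/ell_preserves_sums.
  (* the projections of the powers of [T(p)] are the images of those of [p] *)
  apply: (@pair_ext _ _ _ _ (Tt_bundle X M)).
    change (s' ;; ell_times_zero X M ;; fmap T pi0 =
      s ;; ell_times_zero X M ;; N (T2 X M) ;; fmap T pi0).
    rewrite (compA _ (N _)) -neg_natural -compA (compA s) e0.
    by rewrite (compA s') e0 -compA s0 !compA Nell.
  change (s' ;; ell_times_zero X M ;; fmap T pi1 =
    s ;; ell_times_zero X M ;; N (T2 X M) ;; fmap T pi1).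
  rewrite (compA _ (N _)) -neg_natural -compA (compA s) e1.
  by rewrite (compA s') e1 -compA s1 !compA zero_neg.
rewrite (compA (s ;; H)) (preserves_sums_neg (@ell_preserves_sums (T M))).
rewrite -compA !(compA _ H) hc_lin -(compA s') es (compA _ (N _)).
by rewrite -neg_natural -!compA.
Qed.

End Vertical.

(** * The almost complex structure *)

Variable D : affine_connection X M.

Local Notation K := (ac_K D).
Local Notation H := (ac_H D).
Local Notation F := (connF N D).
Local Notation R := (Rmap K).
Local Notation U := (Umap X M).

Lemma connF_is_sum :
  is_sum (TB (T M)) (R ;; H) (U ;; mu X M ;; N (T M)) F.
Proof. exact: is_sum_fsum. Qed.

Lemma connF_p : F ;; p (T M) = p (T M).
Proof.
have [_ ->] := is_sum_over connF_is_sum.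
by rewrite compA hc_p pair_pi1.
Qed.

Lemma connF_Tp : F ;; fmap T (p M) = K.
Proof.
have := T_preserves_sums (p M) connF_is_sum.
rewrite (compA R) hc_Tp pair_pi0 (compA _ (N _)) -neg_natural => sF.
apply: is_sum_unique sF _.
suff -> : U ;; mu X M ;; (fmap T (p M) ;; N M) = K ;; p M ;; zero M.
  exact: is_sum_zero.
rewrite -compA (compA U) mu_Tp -!compA pair_pi0 compA zero_neg.
by rewrite p_natural vc_over.
Qed.

Lemma connF_K : F ;; K = fmap T (p M) ;; N M.
Proof.
have := vc_preserves_sums K connF_is_sum.
rewrite (compA R) ac_HK (compA _ (N _)) preserves_sums_neg;
  last exact: vc_preserves_sums.
rewrite -(compA _ K) (compA U) mu_vc -!compA pair_pi0 pair_pi1 => sF.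
apply: is_sum_unique sF _; apply: is_sumC.
have := is_sum_zero (TB M) (fmap T (p M) ;; N M).
by rewrite (compA _ (N M)) neg_over p_natural.
Qed.

Lemma connF_square : F ;; F = N (T M).
Proof.
have FU : F ;; U = R.
  by apply: pair_ext; rewrite compA ?pair_pi0 ?pair_pi1 ?connF_Tp ?connF_p.
have FRH : F ;; R ;; H = U ;; H ;; N (T M).
  apply: (hc_neg K); rewrite compA ?pair_pi0 ?pair_pi1 ?connF_p //.
  exact: connF_K.
have sFF := is_sum_precomp F connF_is_sum.
rewrite -(compA F R) FRH -(compA F (_ ;; _)) -(compA F U) FU in sFF.
have s1 := neg_preserves_sums (is_sum_fsum (TB (T M)) (Rmu_UH_over K H)).
rewrite ac_sum comp1m in s1.
exact: is_sum_unique sFF (is_sumC s1).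
Qed.

End Tangent.

Theorem proposition5p24 (C : category) (X : tangent_structure C)
  (N : negatives X) (M : C) (D : affine_connection X M) :
  connF N D ;; connF N D = idm (T X (T X M)) ;; N (T X M).
Proof. by rewrite comp1m; apply: connF_square. Qed.
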